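(* Let $B=[a,b]\times[c,d]\subset\mathbb{R}^2$ be a rectangle with sides parallel to the coordinate axes. The mapping $\Phi\colon \mathcal{M}_B^{hv}\to C(B)$, $L\mapsto f_L$ (restricted to $B$), is continuous, where $\mathcal{M}_B^{hv}$ is equipped with the Hausdorff metric and the function space is equipped with the norm $\|f\|_{\infty,B}:=\sup_{(x,y)\in B}|f(x,y)|$.
   Context: Here $a<b$ and $c<d$. A set $K\subset\mathbb{R}^2$ is hv-convex if its intersection with every horizontal line and with every vertical line is convex. $\mathcal{M}_B^{hv}$ denotes the collection of all non-empty compact connected hv-convex sets $L\subset\mathbb{R}^2$ whose axis parallel bounding box (the intersection of all axis parallel boxes containing $L$, possibly degenerate) is contained in $B$. For a compact set $K\subset\mathbb{R}^2$ the generalized conic function $f_K\colon\mathbb{R}^2\to\mathbb{R}$ is $f_K(x,y):=\int_K \big(|x-\alpha|+|y-\beta|\big)\,d\alpha\, d\beta$ (Lebesgue integral). $C(B)$ is the vector space of continuous real functions on $B$. The Hausdorff metric is taken with respect to the Euclidean distance. *)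

(* Defs.v *)
From HB Require Import structures.
From mathcomp Require Import all_boot all_order all_algebra.
From mathcomp Require Import all_classical all_reals all_analysis.

Set Implicit Arguments.
Unset Strict Implicit.
Unset Printing Implicit Defensive.

Import Order.TTheory GRing.Theory Num.Theory.
Import numFieldNormedType.Exports.

Local Open Scope classical_set_scope.
Local Open Scope ring_scope.

Section HvConvex.
Context {R : realType}.
Implicit Types (B K L : set (R * R)) (f : R * R -> R) (p q : R * R).

Definition box (a b c d : R) : set (R * R) := `[a, b] `*` `[c, d].

(* Degenerate boxes (segments and points) are allowed. *)
Definition axis_parallel_box B : Prop :=
  exists a b c d : R, [/\ a <= b, c <= d & B = box a b c d].

Definition bounding_box L : set (R * R) :=
  \bigcap_(B in [set B | axis_parallel_box B /\ L `<=` B]) B.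

Definition horizontal_line (y : R) : set (R * R) := [set p | p.2 = y].

Definition vertical_line (x : R) : set (R * R) := [set p | p.1 = x].

Definition hv_convex K : Prop :=
  (forall y : R, convex_set (K `&` horizontal_line y)) /\
  (forall x : R, convex_set (K `&` vertical_line x)).

Definition hv_sets B : set (set (R * R)) :=
  [set L | [/\ L !=set0, compact L, connected L, hv_convex L &
               bounding_box L `<=` B]].

(* The library norm on [R * R] is the maximum norm, hence this definition. *)
Definition euclidean_dist p q : R :=
  Num.sqrt ((p.1 - q.1) ^+ 2 + (p.2 - q.2) ^+ 2).

Definition parallel_body K (r : R) : set (R * R) :=
  [set p | exists2 q, K q & euclidean_dist p q <= r].

(* Meaningful on non-empty bounded sets, where the infimum is over a non-empty
   set of nonnegative reals; a metric on non-empty compact sets. *)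
Definition hausdorff_dist K L : R :=
  inf [set r : R | [/\ 0 <= r, K `<=` parallel_body L r
                             & L `<=` parallel_body K r]].

Definition generalized_conic K p : R :=
  \int[(@lebesgue_measure R \x @lebesgue_measure R)%E]_(q in K)
    (`|p.1 - q.1| + `|p.2 - q.2|).

Definition sup_norm B f : R := sup [set `|f p| | p in B].

End HvConvex.

(* Main.v *)
Require Import Defs.
From HB Require Import structures.
From mathcomp Require Import all_boot all_order all_algebra.
From mathcomp Require Import all_classical all_reals all_analysis.
From mathcomp Require Import measurable_realfun ring lra.

Set Implicit Arguments.
Unset Strict Implicit.
Unset Printing Implicit Defensive.

Import Order.TTheory GRing.Theory Num.Theory.
Import numFieldNormedType.Exports.

Local Open Scope classical_set_scope.
Local Open Scope ring_scope.

(**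
The value [generalized_conic L p] is the integral over [L] of the taxicab
distance to [p], a function bounded on a box [B] by the half-perimeter of [B].
Hence, uniformly in [p] over [B], two compact sets [K] and [L] in [B] have conic
functions that differ by at most this bound times the area of the symmetric
difference ([generalized_conic_dist]), and it suffices to show that the area of
the symmetric difference tends to 0 when [K] tends to [L] in the Hausdorff
distance ([area_diff_small]).

The part [K `\` L] is easy: it lies in a small thickening of [L], and the area
of the thickenings of a compact set decreases to the area of the set
([thickening_area_cvg]).

For [L `\` K], let [p] be a point outside [K].  Convexity of the horizontal and
vertical slices of [K] provides a horizontal and a vertical ray from [p] that
both miss [K].  They bound a quadrant, and [K], being connected, lies either
inside it or outside it.  If moreover every point of [L] is closer than [r] to
[K], then [L] cannot contain all four points [p + (+-r, +-r)], since two opposite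
ones lie at distance [r] from the boundary of the quadrant, on different sides of
it ([hv_convex_mem]).  So [L `\` K] is covered
by the four sets of points of [L] that a diagonal translation by [(+-r, +-r)]
moves out of [L].  Such a set is small when [r] is: the points that the
translation moves into [L] form a set with the area of [L], contained in a
thickening of [L] whose area is hardly larger ([area_diff_translate]).

Continuity of a single conic function holds because it is Lipschitz, with the
area of [L] as constant ([generalized_conic_lipschitz]).
*)

(** * Measurable sets and translations in the plane *)

(** The carrier [R * R] with the product of two Borel sigma-algebras, the one on
    which [lebesgue_measure \x lebesgue_measure] is defined. *)
Notation plane R := (measurableTypeR R * measurableTypeR R)%type.

Lemma lebesgue_measure_translate (R : realType) (v : R) (A : set R) :
  measurable A ->
  lebesgue_measure ((fun x => x + v) @^-1` A) = lebesgue_measure A.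
Proof.
move=> mA.
rewrite -[LHS]/(pushforward lebesgue_measure
  ((fun x => x + v) : _ -> measurableTypeR R) A).
apply/esym/lebesgue_measure_unique => // [|mt X /ocitvP[->|[[x y] /= xy ->]]].
  exact: measurable_funD.
  by rewrite !measure0.
rewrite /pushforward (_ : _ @^-1` _ = `]x - v, y - v]%classic).
  rewrite !lebesgue_measure_itv/= !lte_fin ltrD2r.
  by case: ifP => // _; rewrite -!EFinD opprB addrA subrK.
by apply/seteqP; split => z /=; rewrite !in_itv/= ltrBlDr lerBrDr.
Qed.

(** The boxes with rational centres and radii form a countable base of open sets
    that are measurable as products. *)
Lemma open_plane_measurable (R : realType) (U : set (R * R)) :
  open U -> measurable (U : set (plane R)).
Proof.
move=> oU.
pose b (t : rat * rat * (rat * rat)) : set (R * R) :=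
  ball (ratr t.1.1 : R) (ratr t.1.2) `*` ball (ratr t.2.1 : R) (ratr t.2.2).
have -> : U = \bigcup_(t in [set t | b t `<=` U]) b t.
  apply/seteqP; split => [x Ux|x [t /= tU] /tU//].
  have /= [[A B] /= [xA xB] ABU] : nbhs x U by exact: open_nbhs_nbhs.
  have sub (y : R) (C : set R) : nbhs y C -> exists c r,
      ball (@ratr R c) (ratr r) y /\ ball (@ratr R c) (ratr r) `<=` C.
    move=> yC.
    have [|c [r [/set_mem yB BC]]] :=
        @open_subball_rat R C° y (open_interior _).
      exact/mem_set.
    exists c, r; split=> //.
    by apply: subset_trans BC _; exact: interior_subset.
  have [c [r [c1 c2]]] := sub _ _ xA; have [c' [r' [c1' c2']]] := sub _ _ xB.
  exists ((c, r), (c', r')) => //= z [/= z1 z2].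
  by apply: ABU; split => /=; [exact: c2|exact: c2'].
rewrite bigcup_mkcond; apply: countable_bigcupT_measurable => // t.
case: ifPn => // _; apply: measurableX; exact: measurable_ball.
Qed.

Lemma compact_plane_measurable (R : realType) (K : set (R * R)) :
  compact K -> measurable (K : set (plane R)).
Proof.
move=> cK; rewrite -(setCK K); apply: measurableC; apply: open_plane_measurable.
by apply: closed_openC; apply: compact_closed => //; exact: norm_hausdorff.
Qed.

Section Plane.
Context {R : realType}.
Local Notation mu := (@lebesgue_measure R).
Local Notation mu2 := (mu \x mu)%E.

Lemma area_translate (v : R * R) (A : set (plane R)) : measurable A ->
  mu2 ((fun x : R * R => x + v)%R @^-1` A) = mu2 A.
Proof.
move=> mA.
rewrite -[LHS]/(pushforward mu2 ((fun x : R * R => x + v)%R : _ -> plane R) A).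
apply/esym/product_measure_unique => // [|mt X Y mX mY].
  apply/measurable_fun_pairP; split; apply: measurable_funD => //=.
rewrite /pushforward.
rewrite -[LHS]/(mu2
  (((fun x => x + v.1) @^-1` X) `*` ((fun x => x + v.2) @^-1` Y))).
have mp (w : R) Z : measurable Z -> measurable ((fun x => x + w) @^-1` Z).
  move=> mZ; rewrite -[_ @^-1` _]setTI.
  by apply: measurable_funD.
rewrite product_measure1E; [|exact: (mp v.1)|exact: (mp v.2)].
by congr (_ * _)%E; exact: lebesgue_measure_translate.
Qed.

Lemma measurable_translate (v : R * R) (A : set (plane R)) : measurable A ->
  measurable ((fun x : R * R => x + v) @^-1` A : set (plane R)).
Proof.
move=> mA; rewrite -[_ @^-1` _]setTI.
have : measurable_fun setT ((fun x : R * R => x + v)%R : _ -> plane R).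
  by apply/measurable_fun_pairP; split; apply: measurable_funD => //=.
exact.
Qed.
End Plane.

(** * Horizontally and vertically convex connected sets *)

Section Geometry.
Context {R : realType}.
Implicit Types (A K L : set (R * R)) (p q : R * R) (r s t : R).

Lemma convex_segment A t p q : convex_set A -> A p -> A q ->
  0 <= t <= 1 -> A (t * p.1 + (1 - t) * q.1, t * p.2 + (1 - t) * q.2).
Proof.
move=> cA /mem_set Ap /mem_set Aq /andP[t0 t1].
exact: set_mem (cA p q (Itv01 t0 t1) Ap Aq).
Qed.

Lemma between_barycenter (x y z : R) : x <= z <= y ->
  exists2 t, 0 <= t <= 1 & z = t * y + (1 - t) * x.
Proof.
move=> /andP[xz zy].
have [xy|xy] := ltP x y; last by exists 0; rewrite ?lexx ?ler01//; lra.
exists ((z - x) / (y - x)); last by field; lra.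
by rewrite divr_ge0 ?ler_pdivrMr ?mul1r/=; lra.
Qed.

Lemma hv_convex_hslice K (y : R) :
  hv_convex K -> is_interval [set x | K (x, y)].
Proof.
move=> [hK _] x x' /= Kx Kx' z /between_barycenter[t t01 ->].
have [] := convex_segment (hK y) (conj Kx' erefl) (conj Kx erefl) t01.
by rewrite /= => + _; congr K; congr pair; ring.
Qed.

Lemma hv_convex_vslice K (x : R) :
  hv_convex K -> is_interval [set y | K (x, y)].
Proof.
move=> [_ vK] y y' /= Ky Ky' z /between_barycenter[t t01 ->].
have [] := convex_segment (vK x) (conj Ky' erefl) (conj Ky erefl) t01.
by rewrite /= => + _; congr K; congr pair; ring.
Qed.

Lemma interval_side (I : set R) (z : R) : is_interval I -> ~ I z ->
  exists2 s : R, s = 1 \/ s = -1 & forall x, I x -> s * (x - z) < 0.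
Proof.
move=> iI Iz; have [[y Iy zy]|nI] := pselect (exists2 y, I y & z <= y).
  exists (-1); [by right|move=> x Ix].
  have [zx|xz] := ltP z x; first lra.
  by case: Iz; apply: (iI x y) => //; rewrite xz zy.
exists 1; [by left|move=> x Ix]; rewrite mul1r subr_lt0 ltNge.
by apply/negP => zx; apply: nI; exists x.
Qed.

(** The balls of [R * R] are those of the maximum norm; being open, they make the
    thickening measurable whatever [L] is. *)
Definition thickening L r : set (R * R) := \bigcup_(q in L) ball q r.

Definition quadrant s t p : set (R * R) :=
  [set q | 0 < s * (q.1 - p.1) /\ 0 < t * (q.2 - p.2)].

(** The two hypotheses on the slices say that [K] misses the boundary of the
    quadrant, so that [K] meets the open quadrant and its closure in the same set,
    which is therefore open and closed in [K]. *)
Lemma connected_quadrant K s t p : connected K -> s != 0 -> t != 0 ->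
  (forall x, K (x, p.2) -> s * (x - p.1) < 0) ->
  (forall y, K (p.1, y) -> t * (y - p.2) < 0) ->
  K `&` quadrant s t p !=set0 -> K `<=` quadrant s t p.
Proof.
move=> cK s0 t0 Kh Kv K0.
pose f q := s * (q.1 - p.1); pose g q := t * (q.2 - p.2).
have cf : continuous f.
  move=> q; apply: cvgM; first exact: cvg_cst.
  by apply: cvgB; [exact: cvg_fst|exact: cvg_cst].
have cg : continuous g.
  move=> q; apply: cvgM; first exact: cvg_cst.
  by apply: cvgB; [exact: cvg_snd|exact: cvg_cst].
suff <- : K `&` quadrant s t p = K by exact: subIsetr.
apply: cK => //.
- exists (quadrant s t p) => //; apply: openI.
    by apply: (open_comp (f := f) (D := [set r | 0 < r])) => [q _|];
      [exact: cf|exact: open_gt].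
  by apply: (open_comp (f := g) (D := [set r | 0 < r])) => [q _|];
    [exact: cg|exact: open_gt].
- exists [set q | 0 <= f q /\ 0 <= g q].
    apply: closedI.
      by apply: (closed_comp (f := f) (D := [set r | 0 <= r])) => [q _|];
        [exact: cf|exact: closed_ge].
    by apply: (closed_comp (f := g) (D := [set r | 0 <= r])) => [q _|];
      [exact: cg|exact: closed_ge].
  apply/seteqP; split => -[x y] [Kq /= [q1 q2]]; split => //=.
    by split; exact: ltW.
  split; rewrite lt_neqAle ?q1 ?q2 andbT eq_sym mulf_eq0 ?(negPf s0)
    ?(negPf t0) /= subr_eq0; apply/eqP => q0.
    by have := Kv y; rewrite -q0 ltNge q2 => /(_ Kq).
  by have := Kh x; rewrite -q0 ltNge q1 => /(_ Kq).
Qed.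

(** If [p] were outside [K], then [K] would miss a horizontal and a vertical ray
    from [p], hence lie inside the quadrant that they bound or outside it.  Two
    opposite points among the four [p + (+-r, +-r)] lie at distance [r] from the
    boundary of that quadrant, one inside and one outside, so that one of them
    would have no point of [K] near it. *)
Lemma hv_convex_mem K L p r : connected K -> hv_convex K ->
  L `<=` thickening K r ->
  (forall s t, s = 1 \/ s = -1 -> t = 1 \/ t = -1 ->
    L (p + (s * r, t * r))) ->
  K p.
Proof.
move=> cK hvK LK Lp; apply: contrapT => Kp.
have Kp' : ~ K (p.1, p.2) by case: p Kp {Lp}.
have [s s1 Kh] := interval_side (hv_convex_hslice (y := p.2) hvK) Kp'.
have [t t1 Kv] := interval_side (hv_convex_vslice (x := p.1) hvK) Kp'.
have [q Kq [q1 q2]] := LK _ (Lp s t s1 t1).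
have Nsign (u : R) : u = 1 \/ u = -1 -> - u = 1 \/ - u = -1.
  by case=> ->; [right|left; rewrite opprK].
have [q' Kq' [q1' q2']] := LK _ (Lp _ _ (Nsign _ s1) (Nsign _ t1)).
have KQ : K `<=` quadrant s t p.
  apply: connected_quadrant => //.
  - by case: s1 => ->; lra.
  - by case: t1 => ->; lra.
  - exists q; split => //; move: q1 q2; rewrite /quadrant /ball /= !ltr_norml.
    by case: s1 => ->; case: t1 => -> /andP[? ?] /andP[? ?]; split; lra.
have [+ _] := KQ _ Kq'; move: q1'; rewrite /ball /= ltr_norml.
by case: s1 => -> /andP[? ?]; lra.
Qed.

End Geometry.

(** * Area of thickenings and of translates *)

Section Area.
Context {R : realType}.
Local Notation mu := (@lebesgue_measure R).
Local Notation mu2 := (mu \x mu)%E.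
Implicit Types (K L : set (R * R)) (v : R * R) (r e : R).

Lemma bounded_area_lty (A : set (plane R)) : measurable A -> bounded_set A ->
  (mu2 A < +oo)%E.
Proof.
move=> mA [M [_ AM]].
pose I : set (measurableTypeR R) := `[- (M + 1), M + 1]%classic.
have mI : measurable (I `*` I : set (plane R)).
  by apply: measurableX; exact: measurable_itv.
have AI : A `<=` I `*` I.
  move=> p Ap; have /= := AM (M + 1) _ p Ap; rewrite ltrDl ltr01.
  move=> /(_ isT); rewrite prod_normE ge_max !ler_norml => /andP[p1 p2].
  by split; rewrite /I /= in_itv.
apply: le_lt_trans (le_measure mu2 (mem_set mA) (mem_set mI) AI) _.
rewrite [X in (X < _)%E](_ : _ = (mu I * mu I)%E); last first.
  by apply: product_measure1E; exact: measurable_itv.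
rewrite /I lebesgue_measure_itv; case: ifP => _.
  by rewrite -EFinD -EFinM ltry.
by rewrite mule0.
Qed.

Lemma compact_area_lty L : compact L -> (mu2 L < +oo)%E.
Proof.
move=> cL; apply: bounded_area_lty; first exact: compact_plane_measurable.
exact: compact_bounded.
Qed.

Lemma thickening_measurable L r : measurable (thickening L r : set (plane R)).
Proof.
apply: open_plane_measurable; apply: bigcup_open => q _; exact: ball_open.
Qed.

Lemma thickening_area_lty L r : compact L -> (mu2 (thickening L r) < +oo)%E.
Proof.
move=> /compact_bounded[M [Mr LM]].
apply: bounded_area_lty; first exact: thickening_measurable.
exists (M + 1 + r); split => [|x Mx p [q /= Lq qp]]; first exact: num_real.
have /= := LM (M + 1) _ _ Lq; rewrite ltrDl ltr01 => /(_ isT) qM.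
move: qp; rewrite -ball_normE /= distrC => qp.
rewrite -(subrK q p); apply: le_trans (ler_normD _ _) _; lra.
Qed.

(** Continuity of the measure from above: [L] is closed, so the thickenings
    decrease to it. *)
Lemma thickening_area_cvg L : compact L ->
  (mu2 (thickening L n.+1%:R^-1) @[n --> \oo] --> mu2 L)%E.
Proof.
move=> cL.
have LE : L = \bigcap_n thickening L n.+1%:R^-1.
  apply/seteqP; split => [p Lp n _|p pL].
    by exists p => //; apply: ballxx.
  rewrite ((closure_id L).1 (compact_closed (@norm_hausdorff _ _) cL)).
  move=> B /nbhs_ballP[e /= e0 eB].
  have [n _ /(_ n (leqnn n))/= ne] := near_infty_natSinv_lt (PosNum e0).
  have [q Lq qp] := pL n I; exists q; split => //; apply: eB.
  by apply: ball_sym; apply: le_ball qp; exact: ltW.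
rewrite [X in _ --> mu2 X]LE; apply: (@nonincreasing_cvg_mu _ _ _ mu2).
- exact: thickening_area_lty.
- by move=> n; exact: thickening_measurable.
- by rewrite -LE; exact: compact_plane_measurable.
- move=> m n mn; apply/subsetPset => p [q Lq qp]; exists q => //.
  by apply: le_ball qp; rewrite lef_pV2 ?posrE ?ltr0n// ler_nat.
Qed.

Lemma thickening_area_lt L e : compact L -> 0 < e ->
  exists2 r, 0 < r & (mu2 (thickening L r) < mu2 L + e%:E)%E.
Proof.
move=> cL e0.
have Lfin : mu2 L \is a fin_num.
  by rewrite ge0_fin_numE//; exact: compact_area_lty.
have : \forall n \near \oo, (mu2 (thickening L n.+1%:R^-1) < mu2 L + e%:E)%E.
  have cF := thickening_area_cvg cL.
  apply: (cF [set y | (y < mu2 L + e%:E)%E]); apply: open_ereal_lt'.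
  by rewrite lteDl// lte_fin.
move=> [n _ /(_ n (leqnn n))/= nL]; exists n.+1%:R^-1 => //.
Qed.

(** The points that the translation moves into [L] have the area of [L] and lie,
    like [L] itself, in the thickening; the points of [L] moved out of [L] lie in
    what remains of the thickening, whose area is at most [e]. *)
Lemma area_diff_translate L v r e : compact L ->
  (mu2 (thickening L r) < mu2 L + e%:E)%E -> `|v.1| < r -> `|v.2| < r ->
  (mu2 (L `\` (fun x => x + v)%R @^-1` L) <= e%:E)%E.
Proof.
move=> cL Le v1 v2.
have Lfin : mu2 L \is a fin_num.
  by rewrite ge0_fin_numE//; exact: compact_area_lty.
set T := _ @^-1` L.
have mL := compact_plane_measurable cL.
have mN := thickening_measurable L r.
have mT : measurable (T : set (plane R)) by exact: measurable_translate.
have TN : T `<=` thickening L r.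
  move=> p Tp; exists (p + v) => //; rewrite -ball_normE /= addrAC subrr add0r.
  by rewrite prod_normE gt_max v1 v2.
have LN : L `<=` thickening L r.
  move=> p Lp; exists p => //; apply: ballxx; exact: le_lt_trans v1.
have D : (mu2 (L `\` T) <= mu2 (thickening L r `\` T))%E.
  by apply: le_measure; rewrite ?inE;
    [exact: measurableD|exact: measurableD|exact: setSD].
apply: le_trans D _; rewrite measureD//; last exact: thickening_area_lty.
rewrite (setIidr TN) [X in (_ - X)%E]area_translate//.
by rewrite leeBlDl// ltW.
Qed.
End Area.

(** * Conic functions *)

Section Conic.
Context {R : realType}.
Local Notation mu := (@lebesgue_measure R).
Local Notation mu2 := (mu \x mu)%E.
Implicit Types (B K L : set (R * R)) (p q v : R * R) (r e : R).

Definition taxicab p q : R := `|p.1 - q.1| + `|p.2 - q.2|.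

Lemma bounding_box_sub L B : bounding_box L `<=` B -> L `<=` B.
Proof. by move=> LB p Lp; apply: LB => A [_]; exact. Qed.

Lemma taxicab_integrable L p : compact L ->
  mu2.-integrable L (EFin \o taxicab p).
Proof.
move=> cL; apply: measurable_bounded_integrable.
- exact: compact_plane_measurable.
- exact: compact_area_lty.
- apply: measurable_funTS; rewrite /taxicab.
  by apply: measurable_funD; apply: measurableT_comp => //;
    apply: measurable_funB.
- have [M [_ LM]] := compact_bounded cL.
  exists (`|p.1| + `|p.2| + (M + 1) + (M + 1)); split; first exact: num_real.
  move=> x Mx q /= Lq; have /= := LM (M + 1) _ q Lq.
  rewrite ltrDl ltr01 => /(_ isT); rewrite prod_normE ge_max => /andP[q1 q2].
  rewrite ger0_norm ?addr_ge0// /taxicab.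
  have := ler_normB p.1 q.1; have := ler_normB p.2 q.2; lra.
Qed.

(** By the triangle inequality each taxicab distance is 1-Lipschitz in [p]. *)
Lemma generalized_conic_lipschitz L p p' : compact L ->
  `|generalized_conic L p - generalized_conic L p'| <=
  taxicab p p' * fine (mu2 L).
Proof.
move=> cL.
have mL := compact_plane_measurable cL.
have ip := taxicab_integrable p cL; have ip' := taxicab_integrable p' cL.
have iB : mu2.-integrable L (EFin \o (fun q => taxicab p q - taxicab p' q)).
  by have := integrableB mL ip ip'.
have ic : mu2.-integrable L (EFin \o (fun=> taxicab p p')).
  apply: measurable_bounded_integrable => //; first exact: compact_area_lty.
  exact: bounded_cst.
rewrite -Rintegral_cst// /generalized_conic.
rewrite -[X in `|X|](RintegralB mL ip ip').
apply: le_trans (le_normr_Rintegral mL iB) _.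
apply: le_Rintegral => //; first exact: integrable_norm.
move=> q _; rewrite /taxicab.
have e1 : `|p.1 - q.1| <= `|p.1 - p'.1| + `|p'.1 - q.1| by exact: ler_distD.
have e2 : `|p.2 - q.2| <= `|p.2 - p'.2| + `|p'.2 - q.2| by exact: ler_distD.
have e3 : `|p'.1 - q.1| <= `|p.1 - p'.1| + `|p.1 - q.1|.
  by rewrite (distrC p.1 p'.1); exact: ler_distD.
have e4 : `|p'.2 - q.2| <= `|p.2 - p'.2| + `|p.2 - q.2|.
  by rewrite (distrC p.2 p'.2); exact: ler_distD.
by rewrite ler_norml; apply/andP; split; lra.
Qed.

Lemma generalized_conic_continuous L :
  compact L -> continuous (generalized_conic L).
Proof.
move=> cL p; apply/cvgrPdist_le => e e0.
(* The summand 1 keeps the Lipschitz constant positive when [L] is null. *)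
pose M := fine (mu2 L) + 1.
have M0 : 0 <= fine (mu2 L) by exact: fine_ge0.
have d0 : 0 < e / (2 * M) by rewrite divr_gt0// mulr_gt0// /M; lra.
apply: (filterS (P := ball p (e / (2 * M)))); last exact: (nbhsx_ballx p _ d0).
move=> q [q1 q2].
apply: le_trans (generalized_conic_lipschitz p q cL) _.
have qd : taxicab p q <= e / M.
  have -> : e / M = e / (2 * M) + e / (2 * M) by rewrite /M; field; lra.
  by apply: lerD; exact: ltW.
apply: (@le_trans _ _ (e / M * M)); last by rewrite divfK// /M; lra.
by apply: ler_pM => //; [rewrite addr_ge0|rewrite /M; lra].
Qed.

(** The integrals over [K `&` L] cancel, and the two that remain are nonnegative
    and estimated by the bound [M] on the integrand. *)
Lemma generalized_conic_dist K L p (M : R) : compact K -> compact L ->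
  (forall q, K q \/ L q -> taxicab p q <= M) ->
  `|generalized_conic K p - generalized_conic L p| <=
  M * (fine (mu2 (K `\` L)) + fine (mu2 (L `\` K))).
Proof.
move=> cK cL KLM.
have mK := compact_plane_measurable cK; have mL := compact_plane_measurable cL.
have split (A A' : set (plane R)) :
    measurable A -> measurable A' -> compact A ->
    generalized_conic A p = \int[mu2]_(q in A `&` A') taxicab p q +
                            \int[mu2]_(q in A `\` A') taxicab p q.
  move=> mA mA' cA; rewrite -Rintegral_setU//.
  - by rewrite setUIDK.
  - exact: measurableI.
  - exact: measurableD.
  - by rewrite setUIDK; exact: taxicab_integrable.
  - by apply/disj_setPS => q [[_ ?] [_]].
have bnd (A A' : set (plane R)) :
    measurable A -> measurable A' -> compact A ->
    (forall q, A q -> taxicab p q <= M) ->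
    0 <= \int[mu2]_(q in A `\` A') taxicab p q <= M * fine (mu2 (A `\` A')).
  move=> mA mA' cA AM.
  have mD : measurable (A `\` A' : set (plane R)) by exact: measurableD.
  rewrite Rintegral_ge0/=; last by move=> q _; rewrite addr_ge0.
  rewrite -Rintegral_cst//; apply: le_Rintegral => //.
  - by apply: integrableS (taxicab_integrable p cA) => //; exact: subDsetl.
  - apply: measurable_bounded_integrable => //; last exact: bounded_cst.
    apply: le_lt_trans (compact_area_lty cA).
    by apply: le_measure; rewrite ?inE//; exact: subDsetl.
  - by move=> q [Aq _]; exact: AM.
have dist_le (x y k l : R) : 0 <= x <= k -> 0 <= y <= l -> `|x - y| <= k + l.
  by move=> /andP[? ?] /andP[? ?]; rewrite ler_norml; apply/andP; split; lra.
rewrite (split K L)// (split L K)// (setIC L K).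
rewrite opprD addrACA subrr add0r mulrDr.
apply: dist_le; apply: bnd => // q Aq; apply: KLM; [left|right]; exact: Aq.
Qed.

(** The common box provides an admissible radius in the definition of the
    Hausdorff distance; over an empty set of radii the infimum would be the
    default value 0 and carry no information. *)
Lemma hausdorff_dist_thickening K L a b c d (r : R) : K !=set0 -> L !=set0 ->
  K `<=` box a b c d -> L `<=` box a b c d -> hausdorff_dist K L < r ->
  K `<=` thickening L r /\ L `<=` thickening K r.
Proof.
move=> [k Kk] [l Ll] KB LB /inf_lt[].
  have BD p q : box a b c d p -> box a b c d q ->
      euclidean_dist p q <= Num.sqrt ((b - a) ^+ 2 + (d - c) ^+ 2).
    move=> [] /= /[!in_itv]/= /andP[? ?] /andP[? ?].
    move=> [] /= /[!in_itv]/= /andP[? ?] /andP[? ?].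
    by apply: ler_wsqrtr; apply: lerD; nra.
  exists (Num.sqrt ((b - a) ^+ 2 + (d - c) ^+ 2)).
  split; first exact: sqrtr_ge0.
    by move=> p Kp; exists l => //; apply: BD; [exact: KB|exact: LB].
  by move=> p Lp; exists k => //; apply: BD; [exact: LB|exact: KB].
move=> s [s0 KL LK] sr.
have near p q : euclidean_dist p q <= s -> ball q r p.
  move=> ds; split; rewrite /ball /= distrC; apply: le_lt_trans sr;
    apply: le_trans ds; rewrite -sqrtr_sqr;
    by apply: ler_wsqrtr; rewrite ?lerDl ?lerDr sqr_ge0.
by split=> q => [/KL|/LK][q' ? /near ?]; exists q'.
Qed.

(** Of the five parts of [e], one bounds the area of [K `\` L] and four bound the
    areas of the sets of points of [L] that a diagonal translation moves out of
    [L]; by [hv_convex_mem] these four sets cover [L `\` K]. *)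
Lemma area_diff_small L e : compact L -> 0 < e -> exists2 r, 0 < r &
  forall K, compact K -> connected K -> hv_convex K ->
  K `<=` thickening L r -> L `<=` thickening K r ->
  fine (mu2 (K `\` L)) + fine (mu2 (L `\` K)) <= e.
Proof.
move=> cL e0; have e5 : 0 < e / 5 by lra.
have [r r0 Lr] := thickening_area_lt cL e5.
(* Half of [r], because [area_diff_translate] needs a translation shorter
   than [r]. *)
exists (r / 2) => [|K cK coK hvK KL LK]; first lra.
have mK := compact_plane_measurable cK; have mL := compact_plane_measurable cL.
have KLe : (mu2 (K `\` L) <= (e / 5)%:E)%E.
  have sub : K `\` L `<=` thickening L r `\` L.
    move=> p [/KL[q Lq qp] Lp]; split => //; exists q => //.
    by apply: le_ball qp; lra.
  apply: (@le_trans _ _ (mu2 (thickening L r `\` L))).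
    apply: le_measure; rewrite ?inE//; apply: measurableD => //.
    exact: thickening_measurable.
  rewrite measureD//; last 2 first.
  - exact: thickening_measurable.
  - exact: thickening_area_lty.
  have LN : L `<=` thickening L r by move=> p Lp; exists p => //; exact: ballxx.
  rewrite (setIidr LN) leeBlDl; first exact: ltW.
  by rewrite ge0_fin_numE//; exact: compact_area_lty.
pose D s t := L `\` (fun x => x + (s * (r / 2), t * (r / 2))) @^-1` L.
have De s t : s = 1 \/ s = -1 -> t = 1 \/ t = -1 ->
    (mu2 (D s t) <= (e / 5)%:E)%E.
  by move=> s1 t1; apply: area_diff_translate cL Lr _ _ => /=;
    rewrite normrM; [case: s1 => ->|case: t1 => ->];
    rewrite ?normrN normr1 gtr0_norm; lra.
have mD s t : measurable (D s t : set (plane R)).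
  by apply: measurableD => //; exact: measurable_translate.
have LKe : (mu2 (L `\` K) <= (e / 5 + e / 5 + (e / 5 + e / 5))%:E)%E.
  have sub : L `\` K `<=` (D 1 1 `|` D 1 (-1)) `|` (D (-1) 1 `|` D (-1) (-1)).
    move=> p [Lp Kp]; apply: contrapT => nD; apply: Kp.
    have H s t : ~ D s t p -> L (p + (s * (r / 2), t * (r / 2))).
      by move=> nDst; apply: contrapT => nL; apply: nDst.
    apply: (hv_convex_mem coK hvK LK) => s t [->|->] [->|->];
      apply: H => h; apply: nD.
    - by left; left.
    - by left; right.
    - by right; left.
    - by right; right.
  apply: (@le_trans _ _
      (mu2 ((D 1 1 `|` D 1 (-1)) `|` (D (-1) 1 `|` D (-1) (-1))))).
    apply: le_measure; rewrite ?inE//; first exact: measurableD.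
    by repeat apply: measurableU.
  apply: le_trans (measureU2 _ _ _) _; [exact: measurableU|exact: measurableU|].
  rewrite EFinD; apply: leeD; rewrite EFinD;
  (apply: le_trans (measureU2 _ _ _) _; [exact: mD|exact: mD|]);
  by apply: leeD; apply: De; by [left|right].
have F (A : set (R * R)) x : (mu2 A <= x%:E)%E -> fine (mu2 A) <= x.
  move=> Ax; rewrite -lee_fin fineK// ge0_fin_numE//.
  exact: le_lt_trans Ax (ltry _).
by have := F _ _ KLe; have := F _ _ LKe; lra.
Qed.

End Conic.

Theorem theorem3 (R : realType) (a b c d : R) (hab : a < b) (hcd : c < d) :
  let B := box a b c d in
  (forall L : set (R * R), hv_sets B L ->
     {within B, continuous (generalized_conic L)}) /\
  (forall L : set (R * R), hv_sets B L ->
     forall eps : R, 0 < eps ->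
     exists2 delta : R, 0 < delta &
       forall K : set (R * R), hv_sets B K ->
         hausdorff_dist K L < delta ->
         sup_norm B (fun p => generalized_conic K p - generalized_conic L p)
           < eps).
Proof.
move=> B; have ab := ltW hab; have cd := ltW hcd.
split=> [L [_ cL _ _ _]|L [L0 cL _ _ /(bounding_box_sub) LB] eps eps0].
  by apply: continuous_subspaceT; exact: generalized_conic_continuous.
pose M := (b - a) + (d - c).
have M0 : 0 < M by rewrite /M; lra.
have e0 : 0 < eps / (2 * M) by rewrite divr_gt0// mulr_gt0.
have [r r0 close] := area_diff_small cL e0.
exists r => // K [K0 cK coK hvK /(bounding_box_sub) KB] KLr.
have [KL LK] := hausdorff_dist_thickening K0 L0 KB LB KLr.
have {}close := close K cK coK hvK KL LK.
apply: (@le_lt_trans _ _ (eps / 2)); last lra.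
apply: ge_sup.
  exists `|generalized_conic K (a, c) - generalized_conic L (a, c)|, (a, c) => //.
  by split; rewrite /= in_itv/= lexx ?ab ?cd.
move=> _ [p Bp <-].
have BM q : B q -> taxicab p q <= M.
  move: Bp => [] /= /[!in_itv]/= /andP[? ?] /andP[? ?].
  move=> [] /= /[!in_itv]/= /andP[? ?] /andP[? ?].
  by apply: lerD; rewrite ler_norml; apply/andP; split; lra.
apply: le_trans (generalized_conic_dist (M := M) cK cL _) _.
  by move=> q [/KB|/LB]; exact: BM.
rewrite (_ : eps / 2 = M * (eps / (2 * M))); last by field; lra.
by rewrite ler_pM2l.
Qed.
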